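(* Let $2\alpha_0+\alpha_1=1$ and consider the system $$\frac{dx}{dt}=x^4y+\alpha_0x^3+\frac t2x^2+1,\qquad \frac{dy}{dt}=-2x^3y^2-3\alpha_0x^2y-txy-\alpha_0^2x-\frac{\alpha_0t}{2}.$$ Make the change of parameters and variables $$\beta_0=\alpha_0+\alpha_1,\quad\beta_1=\alpha_0,\qquad X=\frac1x,\quad Y=-x(xy+\alpha_0),\quad T=t.$$ Then the new system coincides with the system of type $A_1^{(1)}$: $$\frac{dX}{dT}=-X^2+Y-\frac T2,\qquad\frac{dY}{dT}=2XY+\beta_1,$$ with the Hamiltonian $$H_{A_1^{(1)}}(X,Y,T;\beta_0,\beta_1)=\frac12Y^2-\Big(X^2+\frac T2\Big)Y-\beta_1X.$$
   Context: A Hamiltonian system with Hamiltonian $K(X,Y,T)$ means $dX/dT=\partial K/\partial Y$, $dY/dT=-\partial K/\partial X$. *)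

(* Defs.v *)
From mathcomp Require Import all_boot all_order all_algebra.
From mathcomp Require Import all_classical all_reals all_analysis.
Set Implicit Arguments.
Unset Strict Implicit.
Unset Printing Implicit Defensive.
Import Order.TTheory GRing.Theory Num.Theory.
Import numFieldNormedType.Exports.
Local Open Scope classical_set_scope.
Local Open Scope ring_scope.

(* The base field is any numFieldType K, with the topology given by its norm;
   derivatives along 1 are then ordinary derivatives of functions K -> K, that
   is, real derivatives over a realType and holomorphic ones over a field of
   complex numbers. *)

(* A planar nonautonomous system du/ds = (F u v s).1, dv/ds = (F u v s).2. *)
Definition planar_system (K : numFieldType) := K -> K -> K -> K * K.

Definition solves (K : numFieldType) (F : planar_system K) (D : set K)
    (u v : K -> K) : Prop :=
  forall s : K, D s ->
    is_derive s 1 u (F (u s) (v s) s).1 /\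
    is_derive s 1 v (F (u s) (v s) s).2.

Definition has_hamiltonian (K : numFieldType) (F : planar_system K)
    (H : K -> K -> K -> K) : Prop :=
  forall X Y T : K,
    is_derive Y 1 (fun Y' : K => H X Y' T) (F X Y T).1 /\
    is_derive X 1 (fun X' : K => H X' Y T) (- (F X Y T).2).

Definition original_system (K : numFieldType) (alpha0 : K) : planar_system K :=
  fun x y t =>
    (x ^+ 4 * y + alpha0 * x ^+ 3 + t / 2 * x ^+ 2 + 1,
     - (2 * x ^+ 3 * y ^+ 2) - 3 * alpha0 * x ^+ 2 * y - t * x * y
       - alpha0 ^+ 2 * x - alpha0 * t / 2).

Definition A1_system (K : numFieldType) (beta1 : K) : planar_system K :=
  fun X Y T => (- X ^+ 2 + Y - T / 2, 2 * X * Y + beta1).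

(* beta0 does not occur in the formula: it is determined by beta1 through
   beta0 + beta1 = 1. *)
Definition A1_hamiltonian (K : numFieldType) (beta0 beta1 : K) :
    K -> K -> K -> K :=
  fun X Y T => 1 / 2 * Y ^+ 2 - (X ^+ 2 + T / 2) * Y - beta1 * X.

(* (x, y) |-> (X, Y), meaningful for x != 0; the time is unchanged. *)
Definition change_of_variables (K : numFieldType) (alpha0 : K) (p : K * K) :
    K * K :=
  (1 / p.1, - p.1 * (p.1 * p.2 + alpha0)).

(* Main.v *)
(* The reciprocal X = 1/x is nonzero exactly when x is, and y = -X (X Y + alpha0),
   so the change of variables is an involution on pairs with nonzero first
   coordinate, and each system goes into the other by the product and quotient
   rules. *)
Require Import Defs.
From mathcomp Require Import all_boot all_order all_algebra.
From mathcomp Require Import all_classical all_reals all_analysis.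
From mathcomp Require Import ring.
Import Order.TTheory GRing.Theory Num.Theory.
Import numFieldNormedType.Exports.
Local Open Scope classical_set_scope.
Local Open Scope ring_scope.

Lemma is_derive_inv {K : numFieldType} {f : K -> K} {s df : K} :
  f s != 0 -> is_derive s 1 f df ->
  is_derive s 1 (fun t => 1 / f t) (- (f s) ^- 2 * df).
Proof.
move=> fs0 [fs <-].
have -> : (fun t => 1 / f t) = (fun t => (f t)^-1).
  by apply/funext => t; rewrite div1r.
by apply: DeriveDef; [exact: derivableV | rewrite deriveV].
Qed.

Lemma change_of_variablesK {K : numFieldType} (a : K) {p : K * K} :
  p.1 != 0 -> change_of_variables a (change_of_variables a p) = p.
Proof.
case: p => x y /= x0; rewrite /change_of_variables /=.
by congr (_, _); field.
Qed.

Lemma is_derive_change_of_variables2 {K : numFieldType} {a : K} {x y : K -> K}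
    {s dx dy : K} : is_derive s 1 x dx -> is_derive s 1 y dy ->
  is_derive s 1 (fun t => (change_of_variables a (x t, y t)).2)
    (- (2 * x s * y s + a) * dx - x s ^+ 2 * dy).
Proof.
move=> xs ys.
(* Written with the ring operations on functions, the second coordinate is differentiated by the
   [is_derive] instances; it agrees with the pointwise form by conversion. *)
have : is_derive s 1 (- x * (x * y + cst a))
   (- (2 * x s * y s + a) * dx - x s ^+ 2 * dy).
  by apply: is_derive_eq; rewrite /GRing.scale /= /cst !fctE /=; ring.
by [].
Qed.

(** For [X], dividing [x'] by [- x ^+ 2] gives [- x ^+ 2 * y - a * x - t / 2 - 1 / x ^+ 2], that is
    [Y - t / 2 - X ^+ 2]. For [Y], everything cancels except the contribution of the summand [1] of
    [x'], namely [- (2 * x * y + a)], which is [2 * X * Y + a]. *)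
Lemma solves_original_A1 {K : numFieldType} {a : K} {D : set K}
    {x y : K -> K} : (forall t, D t -> x t != 0) ->
  solves (original_system a) D x y ->
  solves (A1_system a) D (fun t => (change_of_variables a (x t, y t)).1)
    (fun t => (change_of_variables a (x t, y t)).2).
Proof.
move=> x0 sol s Ds; have xs0 := x0 s Ds; have [dx dy] := sol s Ds; split.
  apply: (is_derive_eq (is_derive_inv xs0 dx)).
  by rewrite /=; field.
apply: (is_derive_eq (is_derive_change_of_variables2 dx dy)).
by rewrite /=; field.
Qed.

(** Since the change of variables is its own inverse, the same two derivative formulas serve, now
    with the right-hand sides of the A1 system substituted. *)
Lemma solves_A1_original {K : numFieldType} {a : K} {D : set K}
    {X Y : K -> K} : (forall t, D t -> X t != 0) ->
  solves (A1_system a) D X Y ->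
  solves (original_system a) D (fun t => (change_of_variables a (X t, Y t)).1)
    (fun t => (change_of_variables a (X t, Y t)).2).
Proof.
move=> X0 sol s Ds; have Xs0 := X0 s Ds; have [dX dY] := sol s Ds; split.
  apply: (is_derive_eq (is_derive_inv Xs0 dX)).
  by rewrite /=; field.
apply: (is_derive_eq (is_derive_change_of_variables2 dX dY)).
by rewrite /=; field.
Qed.

(** Values and derivatives at a point depend only on the germs of the functions there, so agreement
    near each point of [D] suffices. *)
Lemma near_eq_solves (K : numFieldType) (F : planar_system K) (D : set K)
    (u v u' v' : K -> K) :
  (forall s, D s -> \near s, (u s, v s) = (u' s, v' s)) ->
  solves F D u v -> solves F D u' v'.
Proof.
move=> uv sol s Ds; have [du dv] := sol s Ds.
have nuv := uv s Ds; have [us vs] := nbhs_singleton nuv.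
rewrite -us -vs; split.
  by apply: near_eq_is_derive du; apply: filterS nuv => t [].
by apply: near_eq_is_derive dv; apply: filterS nuv => t [].
Qed.

Lemma A1_has_hamiltonian (K : numFieldType) (beta0 beta1 : K) :
  has_hamiltonian (A1_system beta1) (A1_hamiltonian beta0 beta1).
Proof.
move=> X Y T; split.
  have : is_derive Y 1 (cst (1 / 2) * id ^+ 2 - cst (X ^+ 2 + T / 2) * id
      - cst (beta1 * X)) (A1_system beta1 X Y T).1.
    by apply: is_derive_eq; rewrite /GRing.scale /= /cst /=; field.
  by [].
have : is_derive X 1 (cst (1 / 2 * Y ^+ 2) - (id ^+ 2 + cst (T / 2)) * cst Y
    - cst beta1 * id) (- (A1_system beta1 X Y T).2).
  by apply: is_derive_eq; rewrite /GRing.scale /= /cst /=; field.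
by [].
Qed.

Theorem theorem4p5 (K : numFieldType) (alpha0 alpha1 beta0 beta1 : K)
    (halpha : 2 * alpha0 + alpha1 = 1)
    (hbeta0 : beta0 = alpha0 + alpha1) (hbeta1 : beta1 = alpha0) :
  [/\ beta0 + beta1 = 1,
      set_bij [set p : K * K | p.1 != 0] [set q : K * K | q.1 != 0]
        (change_of_variables alpha0),
      (forall (D : set K) (x y X Y : K -> K),
         (forall t : K, D t -> x t != 0) ->
         (forall t : K, (X t, Y t) = change_of_variables alpha0 (x t, y t)) ->
         solves (original_system alpha0) D x y <->
         solves (A1_system beta1) D X Y)
    & has_hamiltonian (A1_system beta1) (A1_hamiltonian beta0 beta1)].
Proof.
subst beta0 beta1; split.
- by rewrite -halpha; ring.
(* The map preserves the domain, so being an involution there yields both injectivity and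
   surjectivity. *)
- have cv0 (p : K * K) : p.1 != 0 -> (change_of_variables alpha0 p).1 != 0.
    by move=> p0; rewrite /= div1r invr_eq0.
  split=> [p|p q|q /= q0]; first exact: cv0.
    rewrite !inE /= => p0 q0 pq.
    by rewrite -(change_of_variablesK alpha0 p0) pq change_of_variablesK.
  exists (change_of_variables alpha0 q); first exact: cv0.
  exact: change_of_variablesK.
- move=> D x y X Y x0 XY.
  have -> : X = fun t => (change_of_variables alpha0 (x t, y t)).1.
    by apply/funext => t; rewrite -XY.
  have -> : Y = fun t => (change_of_variables alpha0 (x t, y t)).2.
    by apply/funext => t; rewrite -XY.
  split; first exact: solves_original_A1.
  move=> sol.
  have X0 t : D t -> (change_of_variables alpha0 (x t, y t)).1 != 0.
    by move=> /x0 xt0; rewrite /= div1r invr_eq0.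
  (* Off D, x may vanish and y is then lost, so the inverse change of variables
     only recovers (x, y) near the points of D, where X is continuous. *)
  apply: near_eq_solves (solves_A1_original X0 sol) => s Ds.
  have [dX _] := sol s Ds.
  have : {for s, continuous (fun t => (change_of_variables alpha0 (x t, y t)).1)}.
    by apply/differentiable_continuous/derivable1_diffP; case: dX.
  move=> /cvgr_neq0 /(_ (X0 s Ds)) nX0.
  near=> t.
  have Xt0 : (change_of_variables alpha0 (x t, y t)).1 != 0 by near: t.
  (* By the convention that the inverse of [0] is [0], a nonzero reciprocal forces [x t] to be
     nonzero even when [t] lies outside [D]. *)
  have xt0 : x t != 0 by move: Xt0; rewrite /= div1r invr_eq0.
  by rewrite -!surjective_pairing change_of_variablesK.
- exact: A1_has_hamiltonian.
Unshelve. all: by end_near. Qed.
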